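(* Let $\mathcal H=H_*\oplus H_{**}$ be an orthogonal decomposition. Let $T:\mathcal H\rightrightarrows\mathcal H$ be maximal monotone with $\operatorname{zer}T\neq\emptyset$, and suppose the aligned semidefinite proximal scheme for $T$ is implementable relative to this splitting. For each $k\ge0$ let $c_k>0$ and let $B_k:\mathcal H\to\mathcal H$ be self-adjoint and positive semidefinite with common range $H_*$ and common kernel $H_{**}$, and let $B_{k,*}:=B_k|_{H_*}$. Suppose there exist $\alpha_k\ge1$ such that, for $k\ge1$, $$\alpha_k^{-1}\|u\|_{B_{k-1,*}}\le\|u\|_{B_{k,*}}\le\alpha_k\|u\|_{B_{k-1,*}}\qquad\forall\,u\in H_*,$$ with $\prod_{k=1}^\infty\alpha_k<\infty$, and $c_k\to c_\infty\in(0,+\infty]$. Let $\varepsilon_k\in[0,1)$ with $\sum_{k=0}^\infty\varepsilon_k<\infty$, and let $\{z^k\}\subset\mathcal H$, $z^k=(z_*^k,z_{**}^k)$, satisfy $$c_kd_k\le\varepsilon_k\qquad\text{for all }k\ge0,$$ where $d_k:=\operatorname{dist}_{B_{k,*}^{-1}}\bigl(0,\mathcal R_{k,*}(z^{k+1})\bigr)$ and $$\mathcal R_{k,*}(z^{k+1}):=\{r_*\in H_*\mid(r_*,0)\in T(z^{k+1})+c_k^{-1}B_k(z^{k+1}-z^k)\}.$$ Then, for some $\bar z_*$, $$z_*^k\to\bar z_*\in\operatorname{zer}T_*,\qquad z_*^{k+1}-z_*^k\to0.$$ If, in addition, there exists $(\tilde z_*,\tilde w_* )\in\operatorname{gph}T_*$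 such that $T_{**}(\tilde z_*,\tilde w_* )$ is bounded, then $\{z^k\}$ is bounded and every cluster point belongs to $\operatorname{zer}T$. If, furthermore, $T_{**}(\bar z_*,0)=\{\bar z_{**}\}$, then $$z_{**}^k\to\bar z_{**},\qquad z^k\to(\bar z_*,\bar z_{**}),\qquad 0\in T(\bar z_*,\bar z_{**}).$$
   Context: $\mathcal H$ is a finite-dimensional Hilbert space; each $z\in\mathcal H$ is written $z=(z_*,z_{**})$ with $z_*\in H_*$, $z_{**}\in H_{**}$ its orthogonal components. $\operatorname{zer}F:=\{z\mid0\in F(z)\}$. The projected mapping $T_*:H_*\rightrightarrows H_*$ and the completion mapping $T_{**}:H_*\times H_*\rightrightarrows H_{**}$ are defined by $$w_*\in T_*(z_* )\iff\exists z_{**}\in H_{**}\text{ such that }(w_*,0)\in T(z_*,z_{**}),$$ $$T_{**}(z_*,w_* ):=\{z_{**}\in H_{**}\mid(w_*,0)\in T(z_*,z_{**})\}.$$ A self-adjoint positive semidefinite linear operator $B:\mathcal H\to\mathcal H$ is aligned with the splitting if its range is $H_*$ and its kernel is $H_{**}$. The aligned semidefinite proximal scheme for $T$ is implementable relative to the splitting if, for every $c>0$, every aligned $B$ and every $x\in\mathcal H$, the inclusion $0\in T(z)+c^{-1}B(z-x)$ has at least one solution $z\in\mathcal H$. For a self-adjoint positive definite operator $G$ on a Hilbert space, $\|u\|_G:=\sqrt{\langle Gu,u\rangle}$ and $\operatorname{dist}_G(x,C):=\inf_{v\in C}\|x-v\|_G$, with value $+\infty$ when $C=\emptyset$. The operators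 $B_{k,*}:H_*\to H_*$ are self-adjoint and positive definite. *)

(* Defs.v *)
From HB Require Import structures.
From mathcomp Require Import all_boot all_order all_algebra.
From mathcomp Require Import all_classical all_reals all_analysis.

Set Implicit Arguments.
Unset Strict Implicit.
Unset Printing Implicit Defensive.

Import Order.TTheory GRing.Theory Num.Theory.
Import numFieldNormedType.Exports.
Local Open Scope classical_set_scope.
Local Open Scope ring_scope.

#[short(type="normedVectType")]
HB.structure Definition NormedVector (R : realType) :=
  {V of Vector R V & NormedModule R V}.

(* Completeness is not an axiom: it follows from finite-dimensionality. *)
HB.mixin Record NormedVector_isFinHilbert (R : realType) (V : Type)
    of NormedVector R V := {
  dot : {dot V for idfun};
  dot_normE : forall u : V, `|u| ^+ 2 = dot u u
}.

#[short(type="finHilbertType")]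
HB.structure Definition FinHilbert (R : realType) :=
  {V of NormedVector_isFinHilbert R V & NormedVector R V}.

Section MonotoneMappings.
Variables (R : realType) (H : finHilbertType R).
Implicit Types T S : H -> set H.

Definition monotone_mapping T :=
  forall x y u v, T x u -> T y v -> 0 <= dot (x - y) (u - v).

Definition maximal_monotone T :=
  monotone_mapping T /\
  forall S, monotone_mapping S -> (forall x, T x `<=` S x) -> forall x, S x = T x.

End MonotoneMappings.

Definition zer (U W : zmodType) (F : U -> set W) : set U := [set z | F z 0].

Section GNorm.
Variables (R : realType) (W : vectType R) (ip : W -> W -> R).

Definition normG (G : 'End(W)) (u : W) : R := Num.sqrt (ip (G u) u).

(* [ereal_inf set0 = +oo], the convention for an empty C. *)
Definition distG (G : 'End(W)) (x : W) (C : set W) : \bar R :=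
  ereal_inf [set (normG G (x - v))%:E | v in C].

End GNorm.

Section Splitting.
Variables (R : realType) (H : finHilbertType R).
Variables (Hs Hss : {vspace H}).

Definition orthogonal_decomposition :=
  (Hs + Hss)%VS = fullv /\ {in Hs & Hss, forall u v, dot u v = 0}.

(* The element of H with components (zs, zss). *)
Definition join2 (zs : subvs_of Hs) (zss : subvs_of Hss) : H :=
  vsval zs + vsval zss.

(* The components of z. On its own [vsproj U] projects along the arbitrary
   complement [U^C], hence the prior projection along the other summand. *)
Definition star (z : H) : subvs_of Hs := vsproj Hs (daddv_pi Hs Hss z).
Definition dstar (z : H) : subvs_of Hss := vsproj Hss (daddv_pi Hss Hs z).

Definition dot_star (u v : subvs_of Hs) : R := dot (vsval u) (vsval v).

Definition projected (T : H -> set H) (zs : subvs_of Hs) :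
    set (subvs_of Hs) :=
  [set ws | exists zss, T (join2 zs zss) (join2 ws 0)].

Definition completion (T : H -> set H) (zs ws : subvs_of Hs) :
    set (subvs_of Hss) :=
  [set zss | T (join2 zs zss) (join2 ws 0)].

Definition selfadjoint (B : 'End(H)) := forall u v, dot (B u) v = dot u (B v).

Definition psd (B : 'End(H)) := forall u, 0 <= dot (B u) u.

Definition aligned (B : 'End(H)) :=
  [/\ selfadjoint B, psd B, limg B = Hs & lker B = Hss].

Definition implementable (T : H -> set H) :=
  forall (c : R) (B : 'End(H)) (x : H), 0 < c -> aligned B ->
    exists z w, T z w /\ 0 = w + c^-1 *: B (z - x).

(* The restriction of B to Hs, as an endomorphism of Hs; for an aligned B,
   [vsproj Hs] is only a change of codomain since B takes its values in Hs. *)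
Definition restrict_star (B : 'End(H)) : 'End(subvs_of Hs) :=
  linfun (fun u : subvs_of Hs => vsproj Hs (B (vsval u))).

Definition residual_star (T : H -> set H) (c : R) (B : 'End(H)) (x z : H) :
    set (subvs_of Hs) :=
  [set r | exists w, T z w /\ join2 r 0 = w + c^-1 *: B (z - x)].

End Splitting.

Arguments projected {R H} Hs Hss T zs _.
Arguments completion {R H} Hs Hss T zs ws _.
Arguments dot_star {R H} Hs u v.
Arguments residual_star {R H} Hs Hss T c B x z _.

(* Main.v *)
Require Import Defs.
From HB Require Import structures.
From mathcomp Require Import all_boot all_order all_algebra.
From mathcomp Require Import all_classical all_reals all_analysis.
From mathcomp Require Import ring lra.
Import Order.TTheory GRing.Theory Num.Theory.
Import numFieldNormedType.Exports.
Import VectorInternalTheory.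
Local Open Scope classical_set_scope.
Local Open Scope ring_scope.

(* Let P be the orthogonal projection onto H_* and |.|_k the seminorm of B_k.
   An approximate step has the form s_k := c_k^-1 B_k (z^k + e_k - z^{k+1}) in
   T(z^{k+1}) with |e_k|_k summable. Monotonicity against a zero x of T gives
     |z^{k+1} - x|_k^2 + |z^k + e_k - z^{k+1}|_k^2 <= |z^k + e_k - x|_k^2,
   so |z^{k+1} - x|_k is quasi-Fejer, hence convergent, and the second term goes
   to 0; thus s_k -> 0 and P z^{k+1} - P z^k -> 0. Implementability with B = P,
   started at a cluster point x^ of P z^k, yields a zero y of T with P y = x^;
   quasi-Fejer monotonicity relative to this y gives P z^k -> P y.
   If z^k were unbounded, a limit direction d would lie in H_** and satisfy
   <d, v> <= 0 for every v in the range of T, so by maximality d would be a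
   recession direction of the bounded anchoring set. The remaining claims
   follow from closedness of the graph of T. *)

(** * Finite-dimensional normed spaces: bounded linear maps and subsequences *)

Section FiniteDimension.
Context {R : realType}.

Lemma linear_rV_bounded n (V : normedModType R) (f : {linear 'rV[R]_n -> V}) :
  exists2 M, 0 <= M & forall x, `|f x| <= M * `|x|.
Proof.
exists (\sum_(i < n) `|f (delta_mx 0 i)|); first exact: sumr_ge0.
move=> x; rewrite {1}[x]row_sum_delta linear_sum mulr_suml.
rewrite (le_trans (ler_norm_sum _ _ _))//; apply: ler_sum => i _.
rewrite linearZ normrZ mulrC ler_wpM2l//.
by rewrite [leRHS]/Num.norm /= mx_normrE; apply: (le_bigmax _ _ (ord0, i)).
Qed.

Lemma linear_rV_continuous n (V : normedModType R)
  (f : {linear 'rV[R]_n -> V}) : continuous f.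
Proof.
have [M M0 fM] := linear_rV_bounded _ _ f.
apply: bounded_linear_continuous; apply/bounded_funP => r; exists (M * r).
by move=> x xr; rewrite (le_trans (fM x))// ler_wpM2l.
Qed.

(** On the compact unit sphere of coordinates [|r2v x|] attains a minimum, positive because [r2v] is
    injective; homogeneity extends the bound to all vectors. *)
Lemma v2r_bounded (V : normedVectType R) :
  exists2 M, 0 <= M & forall u : V, `|v2r u| <= M * `|u|.
Proof.
pose S := [set x : 'rV[R]_(dim V) | `|x| = 1].
have rc : continuous (r2v : 'rV[R]_(dim V) -> V) by exact: linear_rV_continuous.
have cS : compact S.
  apply: bounded_closed_compact.
    by exists 1; split => // y y1 x /= ->; exact: ltW.
  have -> : S = (fun x => `|x|) @^-1` [set 1] by [].
  by apply: closed_comp; [move=> x _; exact: norm_continuous|exact: closed_eq].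
(* An empty sphere forces all coordinates to vanish (dimension 0), and the constant 0 works. *)
have [S0|/set0P/negP] := pselect (S !=set0); last first.
  rewrite negbK => /eqP S0; exists 0 => // u; rewrite mul0r leNgt.
  apply/negP => u0; suff : S (`|v2r u|^-1 *: v2r u) by rewrite S0.
  by rewrite /S/= normrZ normfV normr_id mulVf ?gt_eqF.
have nc : {within S, continuous (fun x => `|r2v x : V|)}.
  apply: continuous_subspaceT => x; apply: continuous_comp; first exact: rc.
  exact: norm_continuous.
have [x0 /set_mem x0S x0P] := compact_EVT_min S0 cS nc.
set m := `|r2v x0 : V| in x0P.
have m0 : 0 < m.
  rewrite normr_gt0; apply/eqP => r0.
  have : x0 = 0 by rewrite -[x0](@r2vK _ V) r0 linear0.
  move: x0S => /[swap] ->; rewrite /S/= normr0 => /esym/eqP.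
  by rewrite oner_eq0.
exists m^-1; first by rewrite invr_ge0 ltW.
move=> u; have [->|u0] := eqVneq u 0; first by rewrite linear0 !normr0 mulr0.
have vu0 : 0 < `|v2r u|.
  by rewrite normr_gt0; apply: contra_neq u0 => h; rewrite -(v2rK u) h linear0.
have /mem_set/x0P : S (`|v2r u|^-1 *: v2r u).
  by rewrite /S/= normrZ normfV normr_id mulVf ?gt_eqF.
rewrite linearZ/= v2rK normrZ normfV normr_id mulrC ler_pdivlMr//.
by rewrite -ler_pdivlMl.
Qed.

Lemma linear_bounded (V : normedVectType R) (W : normedModType R)
    (f : {linear V -> W}) :
  exists2 M, 0 <= M & forall u, `|f u| <= M * `|u|.
Proof.
have [M M0 fM] := linear_rV_bounded _ _ (f \o r2v)%FUN.
have [N N0 vN] := v2r_bounded V.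
exists (M * N) => [|u]; first exact: mulr_ge0.
rewrite -{1}(v2rK u) (le_trans (fM _))// -mulrA; exact: ler_wpM2l.
Qed.

Lemma findim_linear_continuous (V : normedVectType R) (W : normedModType R)
  (f : {linear V -> W}) : continuous f.
Proof.
have [M M0 fM] := linear_bounded _ _ f.
apply: bounded_linear_continuous; apply/bounded_funP => r; exists (M * r).
by move=> x xr; rewrite (le_trans (fM x))// ler_wpM2l.
Qed.

(** The condition [n <= phi n] stands in for strict monotonicity: it already makes [phi] tend to
    infinity. *)
Lemma cvgn_comp (U : topologicalType) (u : nat -> U) (phi : nat -> nat)
    (l : U) :
  (forall n, (n <= phi n)%N) -> u @ \oo --> l -> u (phi n) @[n --> \oo] --> l.
Proof.
move=> phiP ul; apply: cvg_comp ul => A [N _ NA]; exists N => // n /= Nn.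
by apply: NA => /=; exact: leq_trans (phiP n).
Qed.

(** Every tail of [u] meets every ball around [l], so an index beyond [n] with value within
    [1/(n+1)] of [l] can be chosen. *)
Lemma cluster_cvg_subseq (V : normedModType R) (u : nat -> V) (l : V) :
  cluster (u @ \oo) l ->
  exists2 phi : nat -> nat, (forall n, (n <= phi n)%N) &
    u (phi n) @[n --> \oo] --> l.
Proof.
move=> ul.
have step n : exists p, (n <= p)%N && (`|l - u p| < n.+1%:R^-1).
  have [||y [[p /= np <-] xy]] := ul (u @` [set p | (n <= p)%N])
      (ball l n.+1%:R^-1).
  - by exists n => // p /= np; exists p.
  - by apply: nbhsx_ballx; rewrite invr_gt0.
  by exists p; rewrite np; move: xy; rewrite -ball_normE.
exists (fun n => xchoose (step n)) => [n|].
  by case/andP: (xchooseP (step n)).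
apply/cvgrPdist_lt => e e0.
have := @near_infty_natSinv_lt R (PosNum e0).
apply: filterS => n /= ne.
by case/andP: (xchooseP (step n)) => _ /lt_trans; exact.
Qed.

Lemma bounded_cvg_subseq (V : normedVectType R) (u : nat -> V) (M : R) :
  (forall n, `|u n| <= M) ->
  exists2 phi : nat -> nat, (forall n, (n <= phi n)%N) &
    cvgn (u \o phi).
Proof.
move=> uM; have [N N0 vN] := v2r_bounded V.
pose K := [set x : 'rV[R]_(dim V) | `|x| <= N * M].
have cK : compact K.
  apply: bounded_closed_compact.
    exists (N * M); split => [|y yNM x/= xK]; first by rewrite num_real.
    by rewrite (le_trans xK)// ltW.
  have -> : K = (fun x => `|x|) @^-1` [set r | r <= N * M] by [].
  by apply: closed_comp; [move=> x _; exact: norm_continuous|exact: closed_le].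
have [|x [_ /cluster_cvg_subseq[phi phiP vx]]] := cK ((v2r \o u) @ \oo) _.
  exists 0%N => // n _; rewrite /K/= (le_trans (vN _))//; exact: ler_wpM2l.
exists phi => //; apply/cvg_ex; exists (r2v x).
have : r2v (v2r (u (phi n))) @[n --> \oo] --> (r2v x : V).
  exact: continuous_cvg _ (linear_rV_continuous _ V r2v x) vx.
by under eq_fun do rewrite v2rK.
Qed.

(** Otherwise infinitely many terms stay at distance at least some [e > 0] from [l], and a
    convergent subsequence of these would have a limit other than [l]. *)
Lemma cvg_of_subseq_limits (V : normedVectType R) (u : nat -> V) (M : R)
    (l : V) :
  (forall n, `|u n| <= M) ->
  (forall (phi : nat -> nat) p, (forall n, (n <= phi n)%N) ->
    u (phi n) @[n --> \oo] --> p -> p = l) ->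
  u @ \oo --> l.
Proof.
move=> uM lP; apply/cvgrPdist_lt => e e0; apply: contrapT => nl.
have step n : exists p, (n <= p)%N && (e <= `|l - u p|).
  apply: contrapT => np; apply: nl; exists n => // p /= n_p.
  by rewrite ltNge; apply/negP => ep; apply: np; exists p; rewrite n_p.
pose phi n := xchoose (step n).
have phiP n : (n <= phi n)%N && (e <= `|l - u (phi n)|) := xchooseP (step n).
have [psi psiP /cvg_ex[p up]] := bounded_cvg_subseq _ _ _ (fun n => uM (phi n)).
have pl : p = l.
  apply: (lP (phi \o psi)) up => n /=.
  by case/andP: (phiP (psi n)) => /(leq_trans (psiP n)).
move/cvgrPdist_lt: up => /(_ _ e0)[n _ /(_ n (leqnn n))].
by rewrite pl /= ltNge; case/andP: (phiP (psi n)) => _ ->.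
Qed.

End FiniteDimension.

(** * Inner product and seminorms of semidefinite operators *)

Section InnerProduct.
Context {R : realType} {H : finHilbertType R}.
Implicit Types (u v w : H) (B : 'End(H)).

Lemma dotC u v : dot u v = dot v u.
Proof. by rewrite hermC /= expr0 mul1r. Qed.

Lemma dotDl u v w : dot (u + v) w = dot u w + dot v w.
Proof. by rewrite linearDl. Qed.

Lemma dotDr u v w : dot u (v + w) = dot u v + dot u w.
Proof. by rewrite linearDr. Qed.

Lemma dotNl u v : dot (- u) v = - dot u v.
Proof. by rewrite linearNl. Qed.

Lemma dotNr u v : dot u (- v) = - dot u v.
Proof. by rewrite linearNr. Qed.

Lemma dotZl a u v : dot (a *: u) v = a * dot u v.
Proof. by rewrite linearZl_LR. Qed.

Lemma dotZr a u v : dot u (a *: v) = a * dot u v.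
Proof. by rewrite linearZr_LR. Qed.

Lemma sqrnormD u v : `|u + v| ^+ 2 = `|u| ^+ 2 + 2 * dot u v + `|v| ^+ 2.
Proof. by rewrite !dot_normE dotDl !dotDr (dotC v u); ring. Qed.

Lemma dot_polar u v : dot u v = (`|u + v| ^+ 2 - `|u - v| ^+ 2) / 4.
Proof. by rewrite !sqrnormD normrN dotNr; field. Qed.

(** Polarization reduces this to the continuity of the norm. *)
Lemma cvg_dot (I : Type) (F : set_system I) (FF : Filter F) (f g : I -> H) u v :
  f @ F --> u -> g @ F --> v -> dot (f x) (g x) @[x --> F] --> dot u v.
Proof.
move=> fu gv; under eq_fun do rewrite dot_polar.
rewrite dot_polar; apply: cvgMl; apply: cvgB.
  have h : `|f x + g x| @[x --> F] --> `|u + v| by apply: cvg_norm; exact: cvgD.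
  by under eq_fun do rewrite expr2; rewrite expr2; exact: cvgM.
have h : `|f x - g x| @[x --> F] --> `|u - v| by apply: cvg_norm; exact: cvgB.
by under eq_fun do rewrite expr2; rewrite expr2; exact: cvgM.
Qed.

Lemma dot_self_eq0 u : dot u u = 0 -> u = 0.
Proof.
by rewrite -dot_normE => /eqP; rewrite sqrf_eq0 normr_eq0 => /eqP.
Qed.

Section SemidefiniteNorm.
Variables (B : 'End(H)) (saB : selfadjoint B) (psdB : psd B).

Lemma sqr_normG u : normG dot B u ^+ 2 = dot (B u) u.
Proof. by rewrite sqr_sqrtr. Qed.

Lemma normG_ge0 u : 0 <= normG dot B u.
Proof. exact: sqrtr_ge0. Qed.

Lemma sqr_normGD u v : normG dot B (u + v) ^+ 2 =
  normG dot B u ^+ 2 + 2 * dot (B u) v + normG dot B v ^+ 2.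
Proof.
rewrite !sqr_normG [B _]linearD/= dotDl !dotDr.
by rewrite (saB v u) (dotC v); ring.
Qed.

Lemma normGZ (a : R) u : 0 <= a -> normG dot B (a *: u) = a * normG dot B u.
Proof.
move=> a0; rewrite /normG [B _]linearZ/= dotZl dotZr mulrA.
by rewrite sqrtrM ?mulr_ge0// -expr2 sqrtr_sqr ger0_norm.
Qed.

(** Follows from [|u - t v|_B^2 >= 0] for all real [t]. As [B] is only semidefinite, either seminorm
    may vanish on a nonzero vector; these degenerate cases are treated apart. *)
Lemma normG_Cauchy_Schwarz u v :
  dot (B u) v <= normG dot B u * normG dot B v.
Proof.
have h t : 0 <= normG dot B u ^+ 2 - 2 * t * dot (B u) v
    + t ^+ 2 * normG dot B v ^+ 2.
  have := sqr_ge0 (normG dot B (u + (- t) *: v)).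
  rewrite sqr_normGD dotZr (sqr_normG (_ *: _)) [B (_ *: _)]linearZ/=.
  by rewrite dotZl dotZr -sqr_normG; nra.
have u0 := normG_ge0 u; have v0 := normG_ge0 v.
have [vz|vz] := eqVneq (normG dot B v) 0.
  have [//|d0] := leP (dot (B u) v) (normG dot B u * normG dot B v).
  move: d0; rewrite vz mulr0 => d0.
  (* With [|v|_B = 0] the polynomial is affine in [t]; this [t] would give it the value -1. *)
  have := h ((normG dot B u ^+ 2 + 1) / (2 * dot (B u) v)).
  rewrite vz expr0n/= mulr0 addr0.
  have -> : 2 * ((normG dot B u ^+ 2 + 1) / (2 * dot (B u) v)) * dot (B u) v
    = normG dot B u ^+ 2 + 1 by field; rewrite gt_eqF.
  lra.
have [uz|uz] := eqVneq (normG dot B u) 0.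
  have vp : 0 < normG dot B v ^+ 2 by rewrite exprn_gt0// lt_def vz.
  (* This is the minimizer in [t]; the minimum [- d^2 / n^2] being nonnegative forces [d = 0]. *)
  have := h (dot (B u) v / normG dot B v ^+ 2).
  rewrite uz mul0r.
  set d := dot _ _; set n := normG dot B v in vp vz *.
  have -> : 0 ^+ 2 - 2 * (d / n ^+ 2) * d + (d / n ^+ 2) ^+ 2 * n ^+ 2
    = - (d ^+ 2 / n ^+ 2) by field.
  rewrite oppr_ge0 pmulr_lle0 ?invr_gt0// => d2.
  have /eqP : d ^+ 2 = 0 by apply/eqP; rewrite eq_le d2 sqr_ge0.
  by rewrite sqrf_eq0 => /eqP ->.
(* At this [t] the polynomial is a positive multiple of [m * n - d]. *)
have := h (normG dot B u / normG dot B v).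
set d := dot _ _; set m := normG dot B u in u0 uz *.
set n := normG dot B v in v0 vz *.
have -> : m ^+ 2 - 2 * (m / n) * d + (m / n) ^+ 2 * n ^+ 2
  = 2 * (m / n) * (m * n - d) by field.
by rewrite pmulr_rge0 ?subr_ge0// mulr_gt0// divr_gt0 // lt_def ?uz ?vz.
Qed.

Lemma normGD u v : normG dot B (u + v) <= normG dot B u + normG dot B v.
Proof.
have u0 := normG_ge0 u; have v0 := normG_ge0 v.
rewrite -ler_sqr ?nnegrE ?addr_ge0 ?normG_ge0// sqr_normGD.
by have := normG_Cauchy_Schwarz u v; nra.
Qed.

End SemidefiniteNorm.

Lemma dot_le_norm u v : dot u v <= `|u| * `|v|.
Proof.
have sa1 : selfadjoint (\1%VF : 'End(H)) by move=> x y; rewrite !id_lfunE.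
have psd1 : psd (\1%VF : 'End(H)).
  by move=> x; rewrite id_lfunE -dot_normE sqr_ge0.
have n1 x : normG dot (\1%VF : 'End(H)) x = `|x|.
  by rewrite /normG id_lfunE -dot_normE sqrtr_sqr normr_id.
by have := normG_Cauchy_Schwarz _ sa1 psd1 u v; rewrite !n1 id_lfunE.
Qed.

End InnerProduct.

(** * Orthogonal projections and aligned operators *)

Section OrthogonalSplitting.
Context {R : realType} {H : finHilbertType R}.
Variables (Hs Hss : {vspace H}) (od : orthogonal_decomposition Hs Hss).
Implicit Types (u v w : H) (B : 'End(H)).

Local Notation P := (daddv_pi Hs Hss).
Local Notation Q := (daddv_pi Hss Hs).

Lemma capv_splitting : (Hs :&: Hss = 0)%VS.
Proof.
apply/eqP; rewrite -subv0; apply/subvP => u /[!memv_cap] /andP[us uss].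
by rewrite memv0; apply/eqP/dot_self_eq0/od.2.
Qed.

Lemma add_proj u : P u + Q u = u.
Proof. by rewrite daddv_pi_add ?capv_splitting// od.1 memvf. Qed.

Lemma vsval_star u : vsval (star Hs Hss u) = P u.
Proof. by rewrite vsprojK// memv_pi. Qed.

Lemma vsval_dstar u : vsval (dstar Hs Hss u) = Q u.
Proof. by rewrite vsprojK// memv_pi. Qed.

Lemma join2_star u : join2 (star Hs Hss u) (dstar Hs Hss u) = u.
Proof. by rewrite /join2 vsval_star vsval_dstar add_proj. Qed.

Lemma projs_id u : u \in Hs -> P u = u.
Proof. by move=> uHs; rewrite daddv_pi_id ?capv_splitting. Qed.

Lemma projss_id u : u \in Hss -> Q u = u.
Proof. by move=> uHs; rewrite daddv_pi_id // capvC capv_splitting. Qed.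

Lemma projs_ss u : u \in Hss -> P u = 0.
Proof.
move=> uHss; have := add_proj u; rewrite projss_id// => uE.
by apply: (@addIr _ u); rewrite uE add0r.
Qed.

Lemma dot_projs u v : dot (P u) v = dot u (P v).
Proof.
transitivity (dot (P u) (P v)).
  by rewrite -[v in LHS]add_proj dotDr (od.2 (P u) (Q v)) ?memv_pi// addr0.
rewrite -[u in RHS]add_proj dotDl (dotC (Q u)) (od.2 (P v) (Q u)) ?memv_pi//.
by rewrite addr0.
Qed.

Lemma dot_mem_Hs u v : v \in Hs -> dot (P u) v = dot u v.
Proof. by move=> vHs; rewrite dot_projs projs_id. Qed.

Lemma norm_projs_le u : `|P u| <= `|u|.
Proof.
rewrite -ler_sqr ?nnegrE// -{2}[u]add_proj sqrnormD od.2 ?memv_pi//.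
by rewrite mulr0 addr0 lerDl sqr_ge0.
Qed.

Lemma dot_projs_self u : dot (P u) u = `|P u| ^+ 2.
Proof.
by rewrite dot_normE [RHS]dot_projs (projs_id (P u)) ?memv_pi// dotC.
Qed.

(** Makes [P] an admissible operator in the implementability hypothesis. *)
Lemma aligned_projs : aligned Hs Hss P.
Proof.
split.
- exact: dot_projs.
- by move=> u; rewrite dot_projs_self sqr_ge0.
- apply/eqP; rewrite eqEsubv; apply/andP; split; apply/subvP => u.
    by move=> /memv_imgP[v _ ->]; exact: memv_pi.
  by move=> /projs_id <-; rewrite memv_img ?memvf.
- apply/eqP; rewrite eqEsubv; apply/andP; split; apply/subvP => u.
    rewrite memv_ker => /eqP u0.
    by rewrite -(add_proj u) u0 add0r memv_pi.
  by move=> /projs_ss u0; rewrite memv_ker u0.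
Qed.

Section Aligned.
Variables (B : 'End(H)) (alB : aligned Hs Hss B).

Let saB : selfadjoint B. Proof. by case: alB. Qed.
Let psdB : psd B. Proof. by case: alB. Qed.

Lemma aligned_mem u : B u \in Hs.
Proof. by case: alB => _ _ <- _; rewrite memv_img// memvf. Qed.

Lemma aligned_Hss u : u \in Hss -> B u = 0.
Proof. by case: alB => _ _ _ <-; rewrite memv_ker => /eqP. Qed.

Lemma aligned_projsE u : B (P u) = B u.
Proof.
by rewrite -{2}[u]add_proj linearD/= (aligned_Hss (Q u)) ?memv_pi ?addr0.
Qed.

Lemma normG_projs u : normG dot B (P u) = normG dot B u.
Proof.
rewrite /normG aligned_projsE (dotC _ (P u)) dot_mem_Hs ?aligned_mem//.
by rewrite dotC.
Qed.

Lemma normG_le_norm :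
  exists2 M, 0 <= M & forall u, normG dot B u <= M * `|u|.
Proof.
have [M M0 BM] := linear_bounded _ _ B.
exists (Num.sqrt M) => [|u]; first exact: sqrtr_ge0.
rewrite -ler_sqr ?nnegrE ?mulr_ge0 ?sqrtr_ge0 ?normr_ge0//.
rewrite sqr_normG// exprMn sqr_sqrtr//.
by rewrite (le_trans (dot_le_norm _ _))// expr2 mulrA ler_wpM2r ?BM.
Qed.

(** Cauchy-Schwarz for [u] and [B u] gives [|B u|^2 <= |u|_B |B u|_B <= M |u|_B |B u|]; divide by
    [|B u|]. *)
Lemma norm_aligned_le (M : R) : 0 <= M ->
  (forall u, normG dot B u <= M * `|u|) ->
  forall u, `|B u| <= M * normG dot B u.
Proof.
move=> M0 BM u; have [->|Bu0] := eqVneq (B u) 0.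
  by rewrite normr0 mulr_ge0 ?normG_ge0.
have Bp : 0 < `|B u| by rewrite normr_gt0.
rewrite -(ler_pM2r Bp) -expr2 dot_normE.
rewrite (le_trans (normG_Cauchy_Schwarz _ saB psdB _ _))//.
by rewrite (mulrAC M) [leLHS]mulrC ler_wpM2r ?normG_ge0 ?BM.
Qed.

(** The generalized inverse recovers [u] from [B u] up to the kernel of [B], which is [Hss] and is
    killed by [P]; hence [|P u|] is controlled by [|B u|], and so by the seminorm. *)
Lemma norm_projs_le_normG :
  exists2 M, 0 <= M & forall u, `|P u| <= M * normG dot B u.
Proof.
have [M M0 BM] := normG_le_norm.
have [N N0 VN] := linear_bounded _ _ (B^-1)%VF.
exists (N * M) => [|u]; first exact: mulr_ge0.
have -> : P u = P ((B^-1)%VF (B u)).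
  apply/eqP; rewrite -subr_eq0 -linearB/=; apply/eqP/projs_ss.
  case: alB => _ _ _ <-; rewrite memv_ker linearB/= limg_lfunVK ?subrr//.
  by rewrite memv_img ?memvf.
rewrite (le_trans (norm_projs_le _))// (le_trans (VN _))// -mulrA.
by apply: ler_wpM2l => //; exact: norm_aligned_le.
Qed.

Lemma vsval_restrict_star (u : subvs_of Hs) :
  vsval (restrict_star Hs B u) = B (vsval u).
Proof.
rewrite /restrict_star (lfunE (vsproj Hs \o B \o vsval))/= vsprojK//.
exact: aligned_mem.
Qed.

Lemma normG_restrict_star (u : subvs_of Hs) :
  normG (dot_star Hs) (restrict_star Hs B) u = normG dot B (vsval u).
Proof. by rewrite /normG /dot_star vsval_restrict_star. Qed.

(** Ensures that the inverse of [restrict_star] used in the distance is a genuine inverse. A kernel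
    element lies in both summands, hence is orthogonal to itself. *)
Lemma lker_restrict_star : lker (restrict_star Hs B) = 0%VS.
Proof.
apply/eqP; rewrite -subv0; apply/subvP => u; rewrite memv_ker memv0 => /eqP u0.
apply/eqP/val_inj => /=.
have us : vsval u \in Hs by exact: subvsP.
have uss : vsval u \in Hss.
  by case: alB => _ _ _ <-; rewrite memv_ker -vsval_restrict_star u0 linear0.
by apply: dot_self_eq0; exact: od.2.
Qed.

(** Trades the distance criterion for a perturbation of the starting point: a residual [r] of norm
    below [(eps + delta) / c] is absorbed by [e := c B_*^-1 r], for which [B e = c r]. *)
Lemma residual_perturbation (T : H -> set H) (c eps delta : R) x z :
  0 < c -> 0 < delta ->
  (c%:E * distG (dot_star Hs) (restrict_star Hs B)^-1%VF 0
     (residual_star Hs Hss T c B x z) <= eps%:E)%E ->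
  exists e, normG dot B e <= eps + delta /\ T z (c^-1 *: B (x + e - z)).
Proof.
move=> c0 delta0 hd.
have : (distG (dot_star Hs) (restrict_star Hs B)^-1%VF 0
     (residual_star Hs Hss T c B x z) < ((eps + delta) / c)%:E)%E.
  rewrite -(@lte_pmul2l _ c%:E)// ?lte_fin//.
  rewrite (le_lt_trans hd)// -EFinM lte_fin mulrC divfK ?gt_eqF//.
  by rewrite ltrDl.
move=> /ereal_inf_lt[_ [r [w [Tw rw]] <-]]; rewrite lte_fin => rlt.
set G := restrict_star Hs B in rlt *.
have GK : cancel G^-1%VF G by apply: lker0_lfunVK; rewrite lker_restrict_star.
pose g := (G^-1)%VF r.
have Bg : B (vsval g) = vsval r by rewrite -vsval_restrict_star GK.
(* Both squares equal the inner product of [r] and [B_*^-1 r]. *)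
have ng : normG dot B (vsval g) = normG (dot_star Hs) (G^-1)%VF (0 - r).
  rewrite /normG sub0r [_^-1%VF _]linearN/= -/g /dot_star !raddfN/= dotNl opprK.
  by rewrite Bg dotC.
exists (c *: vsval g); split.
  by rewrite normGZ ?(ltW c0)// ng mulrC -ler_pdivlMr// ltW.
move: rw; rewrite /join2 linear0 addr0 => rw.
suff <- : w = c^-1 *: B (x + c *: vsval g - z) by [].
have -> : x + c *: vsval g - z = c *: vsval g - (z - x).
  by rewrite opprB addrA addrAC addrC addrA.
rewrite linearB/= linearZ/= Bg rw scalerBr scalerA mulVf ?gt_eqF// scale1r.
by rewrite addrK.
Qed.

End Aligned.

End OrthogonalSplitting.

(** * Series, infinite products and quasi-Fejer sequences of reals *)

Section RealSequences.
Context {R : realType}.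

Lemma nneseries_lty_cvg (eps : nat -> R) : (forall k, 0 <= eps k) ->
  (\sum_(0 <= k <oo) (eps k)%:E < +oo)%E -> cvgn (series eps).
Proof.
move=> eps0 h; apply: nondecreasing_is_cvgn.
  by apply: nondecreasing_series => n _ _; exact: eps0.
have fin : (\sum_(0 <= k <oo) (eps k)%:E \is a fin_num)%E.
  rewrite ge0_fin_numE//; apply: nneseries_ge0 => n _ _.
  by rewrite lee_fin.
exists (fine (\sum_(0 <= k <oo) (eps k)%:E)%E) => _ [n _ <-].
rewrite -lee_fin fineK// /series/= -sumEFin.
by apply: nneseries_lim_ge => k _ _; rewrite lee_fin.
Qed.

Lemma prod_ge1 (alpha : nat -> R) n : (forall k, 1 <= alpha k) ->
  1 <= \prod_(0 <= k < n) alpha k.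
Proof.
move=> a1; elim: n => [|n ih]; first by rewrite big_nil.
by rewrite big_nat_recr//= mulr_ege1.
Qed.

Lemma prod_nondecreasing (alpha : nat -> R) : (forall k, 1 <= alpha k) ->
  nondecreasing_seq (fun n => \prod_(0 <= k < n) alpha k).
Proof.
move=> a1; apply/nondecreasing_seqP => n.
by rewrite big_nat_recr//= ler_peMr// (le_trans ler01)// prod_ge1.
Qed.

(** Each factor is a ratio of consecutive partial products, whose limit is at least 1 and so can be
    divided by. *)
Lemma cvg_prod_cvg1 (alpha : nat -> R) : (forall k, 1 <= alpha k) ->
  cvgn (fun n => \prod_(0 <= k < n) alpha k) -> alpha @ \oo --> (1 : R).
Proof.
move=> a1 cA; pose A n := \prod_(0 <= k < n) alpha k.
have A0 n : A n != 0 by rewrite gt_eqF// (lt_le_trans ltr01)// prod_ge1.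
have l0 : limn A != 0.
  rewrite gt_eqF// (lt_le_trans ltr01)//; apply: limr_ge => //.
  by apply: nearW => n; exact: prod_ge1.
have -> : alpha = (fun n => A n.+1 / A n).
  by apply/funext => n; rewrite /A big_nat_recr//= mulrAC mulfV ?mul1r// A0.
rewrite -(divff l0); apply: cvgM; last exact: cvgV.
by rewrite (cvg_shiftS A); exact: cA.
Qed.

(* Dividing by the partial products of [alpha] and subtracting the partial sums
   of [eps] turns [a] into a nonincreasing sequence. *)
Lemma quasi_fejer_cvg (a alpha eps : nat -> R) :
  (forall k, 0 <= a k) -> (forall k, 1 <= alpha k) -> (forall k, 0 <= eps k) ->
  (forall k, a k.+1 <= alpha k * a k + eps k) ->
  cvgn (fun n => \prod_(0 <= k < n) alpha k) -> cvgn (series eps) -> cvgn a.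
Proof.
move=> a0 a1 e0 aS cA cE; pose A n := \prod_(0 <= k < n) alpha k.
have A1 n : 1 <= A n by exact: prod_ge1.
have A0 n : 0 < A n by rewrite (lt_le_trans ltr01).
pose d n := a n / A n - series eps n.
have cd : cvgn d.
  apply: nonincreasing_is_cvgn.
    apply/nonincreasing_seqP => n.
    have AS : A n.+1 = A n * alpha n by rewrite /A big_nat_recr.
    (* The error is divided by [A n.+1 >= 1], which only decreases it. *)
    have h : a n.+1 / A n.+1 <= a n / A n + eps n.
      rewrite ler_pdivrMr// (le_trans (aS n))// mulrDl lerD// ?ler_peMr//.
      by rewrite AS mulrA divfK ?gt_eqF// mulrC.
    by rewrite /d !seriesEnat/= big_nat_recr//=; lra.
  exists (- limn (series eps)) => _ [n _ <-]; rewrite /d.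
  have : series eps n <= limn (series eps).
    apply: nondecreasing_cvgn_le => //.
    by apply: nondecreasing_series => k _ _; exact: e0.
  have : 0 <= a n / A n by rewrite divr_ge0// ltW.
  by lra.
have -> : a = (fun n => (d n + series eps n) * A n).
  by apply/funext => n; rewrite /d subrK divfK// gt_eqF.
exact: is_cvgM (is_cvgD cd cE) cA.
Qed.

End RealSequences.

(** * Maximal monotone mappings *)

Section MaximalMonotone.
Context {R : realType} {H : finHilbertType R}.
Variables (T : H -> set H) (mmT : maximal_monotone T).

(** Adding the pair [(x, u)] to the graph keeps it monotone, so by maximality the pair was already
    there. *)
Lemma maximal_monotone_mem x u :
  (forall y v, T y v -> 0 <= dot (x - y) (u - v)) -> T x u.
Proof.
move=> xu; case: mmT => mT maxT.
pose S y := T y `|` [set v | y = x /\ v = u].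
have SE : S x = T x.
  apply: maxT => [y1 y2 v1 v2|y v Tv]; last by left.
  move=> [Tv1|[-> ->]] [Tv2|[-> ->]].
  - exact: mT.
  - by rewrite -(opprB x) -(opprB u) dotNl dotNr opprK; exact: xu.
  - exact: xu.
  - by rewrite subrr linear0l.
by rewrite -SE; right.
Qed.

(** The monotonicity inequality against each fixed pair of the graph passes to the limit. *)
Lemma maximal_monotone_closed (x u : nat -> H) x0 u0 :
  (forall n, T (x n) (u n)) -> x @ \oo --> x0 -> u @ \oo --> u0 -> T x0 u0.
Proof.
move=> Txu xx0 uu0; apply: maximal_monotone_mem => y v Tyv.
have h : dot (x n - y) (u n - v) @[n --> \oo] --> dot (x0 - y) (u0 - v).
  by apply: cvg_dot; apply: cvgB => //; exact: cvg_cst.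
rewrite -(cvg_lim _ h)//; apply: limr_ge.
  by apply/cvg_ex; eexists; exact: h.
by apply: nearW => n; exact: mmT.1.
Qed.

End MaximalMonotone.

Lemma cvg0_norm_le {R : realType} {V : normedModType R} (f : nat -> V) (C : R)
    (g : nat -> R) :
  (\forall n \near \oo, `|f n| <= C * g n) -> g @ \oo --> (0 : R) ->
  f @ \oo --> (0 : V).
Proof.
move=> fg g0; apply: norm_cvg0.
apply: (squeeze_cvgr (f := fun=> 0) (h := fun n => C * g n)).
- by apply: filterS fg => n ->; rewrite normr_ge0.
- exact: cvg_cst.
- by rewrite -(mulr0 C); apply: cvgMr.
Qed.

Lemma bounded_near_globally {R : realType} {V : normedModType R} (I : Type)
    (f : I -> V) (D : set I) :
  bounded_near f (globally D) -> exists M, forall x, D x -> `|f x| <= M.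
Proof.
move=> [M [_ /(_ (M + 1))]]; rewrite ltrDl ltr01 => /(_ isT) fM.
by exists (M + 1).
Qed.

(** * The perturbed proximal iteration: convergence of the [Hs] component *)

Section ProximalIteration.
Context {R : realType} {H : finHilbertType R}.
Variables (Hs Hss : {vspace H}) (od : orthogonal_decomposition Hs Hss).
Variables (T : H -> set H) (mmT : maximal_monotone T).
Variables (c alpha eta : nat -> R) (B : nat -> 'End(H)) (z e : nat -> H).
Hypotheses (c_gt0 : forall k, 0 < c k) (alB : forall k, aligned Hs Hss (B k)).
Hypothesis alpha_ge1 : forall k, 1 <= alpha k.
Hypothesis normG_succ_le :
  forall k u, normG dot (B k.+1) u <= alpha k * normG dot (B k) u.
Hypothesis normG_le_succ :
  forall k u, normG dot (B k) u <= alpha k * normG dot (B k.+1) u.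
Hypothesis cvg_alpha : cvgn (fun n => \prod_(0 <= k < n) alpha k).
Hypotheses (eta_ge0 : forall k, 0 <= eta k) (cvg_eta : cvgn (series eta)).
Hypothesis e_le : forall k, normG dot (B k) (e k) <= eta k.
Hypothesis zT : forall k, T (z k.+1) ((c k)^-1 *: B k (z k + e k - z k.+1)).
(** An eventual positive lower bound covers finite and infinite limits of [c] alike. *)
Variable c_min : R.
Hypotheses (c_min_gt0 : 0 < c_min) (c_ge : \forall k \near \oo, c_min <= c k).

Local Notation P := (daddv_pi Hs Hss).
Local Notation N k := (normG dot (B k)).

Let saB k : selfadjoint (B k). Proof. by case: (alB k). Qed.
Let psdB k : psd (B k). Proof. by case: (alB k). Qed.
Let A n := \prod_(0 <= k < n) alpha k.

Let A_le n : A n <= limn A.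
Proof. by apply: nondecreasing_cvgn_le => //; exact: prod_nondecreasing. Qed.

Let A_ge1 n : 1 <= A n.
Proof. exact: prod_ge1. Qed.

Lemma normG_le0 k u : N k u <= limn A * N 0%N u.
Proof.
apply: (@le_trans _ _ (A k * N 0%N u)); last by rewrite ler_wpM2r ?normG_ge0.
elim: k => [|k ih]; first by rewrite /A big_nil mul1r.
rewrite (le_trans (normG_succ_le k u))// /A big_nat_recr//= mulrAC mulrC.
by rewrite ler_wpM2r// (le_trans ler01).
Qed.

Lemma normG0_le k u : N 0%N u <= limn A * N k u.
Proof.
apply: (@le_trans _ _ (A k * N k u)); last by rewrite ler_wpM2r ?normG_ge0.
elim: k => [|k ih]; first by rewrite /A big_nil mul1r.
rewrite (le_trans ih)// /A big_nat_recr//= -mulrA.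
by rewrite ler_wpM2l// (le_trans ler01 (A_ge1 _)).
Qed.

(** Comparison through [B 0] yields one constant for all [k], so smallness in the varying seminorms
    is smallness of the [Hs] component. *)
Lemma norm_projs_unif : exists2 C, 0 <= C & forall k u, `|P u| <= C * N k u.
Proof.
have [M M0 PM] := norm_projs_le_normG _ _ od _ (alB 0).
have A0 : 0 <= limn A by rewrite (le_trans ler01)// (le_trans (A_ge1 0)).
exists (M * limn A) => [|k u]; first exact: mulr_ge0.
by rewrite (le_trans (PM u))// -mulrA ler_wpM2l// normG0_le.
Qed.

Lemma normG_unif : exists2 C, 0 <= C & forall k u, N k u <= C * `|P u|.
Proof.
have [M M0 NM] := normG_le_norm _ _ _ (alB 0).
have A0 : 0 <= limn A by rewrite (le_trans ler01)// (le_trans (A_ge1 0)).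
exists (limn A * M) => [|k u]; first exact: mulr_ge0.
rewrite -(normG_projs _ _ od _ (alB k)) (le_trans (normG_le0 _ _))// -mulrA.
by rewrite ler_wpM2l ?NM.
Qed.

Lemma eta_cvg0 : eta @ \oo --> (0 : R).
Proof. exact: cvg_series_cvg_0. Qed.

Let r k := z k + e k - z k.+1.

(** Expand the square of [r k + (z k.+1 - x0)]: the cross term is nonnegative by monotonicity
    between [z k.+1] and the zero [x0]. *)
Lemma proximal_step_le x0 k : T x0 0 ->
  N k (z k.+1 - x0) ^+ 2 + N k (r k) ^+ 2 <= N k (z k + e k - x0) ^+ 2.
Proof.
move=> T0; have -> : z k + e k - x0 = r k + (z k.+1 - x0).
  by rewrite /r addrA subrK.
rewrite [leRHS]sqr_normGD//.
have := mmT.1 _ _ _ _ (zT k) T0; rewrite subr0 dotZr dotC -/(r k).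
rewrite pmulr_rge0 ?invr_gt0//; lra.
Qed.

Lemma proximal_err_le x0 k :
  N k.+1 (z k.+1 + e k.+1 - x0) <= alpha k * N k (z k.+1 - x0) + eta k.+1.
Proof.
rewrite addrAC (le_trans (normGD _ _ _ _ _))// lerD//.
Qed.

(** Drops the residual in [proximal_step_le]; the change of seminorm costs [alpha k]. Iterates run
    one index ahead of seminorms because [z k.+1] is computed with [B k]. *)
Lemma proximal_fejer x0 k : T x0 0 ->
  N k.+1 (z k.+2 - x0) <= alpha k * N k (z k.+1 - x0) + eta k.+1.
Proof.
move=> T0; apply: le_trans (proximal_err_le _ _).
rewrite -ler_sqr ?nnegrE ?normG_ge0//.
by rewrite (le_trans _ (proximal_step_le _ _ T0))// lerDl sqr_ge0.
Qed.

Lemma proximal_cvg_dist x0 : T x0 0 -> cvgn (fun k => N k (z k.+1 - x0)).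
Proof.
move=> T0; apply: (quasi_fejer_cvg _ alpha (fun k => eta k.+1)) => //.
- by move=> k; exact: normG_ge0.
- by move=> k; exact: proximal_fejer.
- have -> : series (fun k => eta k.+1) = (fun n => series eta n.+1 - eta 0%N).
    apply/funext => n.
    by rewrite !seriesEnat/= [in RHS]big_nat_recl//= addrC addKr.
  apply: is_cvgB; last exact: is_cvg_cst.
  apply/cvg_ex; exists (limn (series eta)).
  by rewrite (cvg_shiftS (series eta)).
Qed.

(** The squared residual is at most the gap between the squared Fejer bound and the next squared
    distance; both tend to [l^2], as [alpha] tends to 1 and [eta] to 0. *)
Lemma proximal_residual_cvg0 x0 : T x0 0 -> N k (r k) @[k --> \oo] --> (0 : R).
Proof.
move=> T0; have /cvg_ex[l al] := proximal_cvg_dist _ T0.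
have alS : N k.+1 (z k.+2 - x0) @[k --> \oo] --> l.
  by rewrite (cvg_shiftS (fun k => N k (z k.+1 - x0))).
rewrite -cvg_shiftS.
have h : (alpha k * N k (z k.+1 - x0) + eta k.+1) ^+ 2
    - N k.+1 (z k.+2 - x0) ^+ 2 @[k --> \oo] --> (0 : R).
  have -> : 0 = (1 * l + 0) * (1 * l + 0) - l * l :> R by ring.
  under eq_fun do rewrite !expr2.
  have hb : alpha k * N k (z k.+1 - x0) + eta k.+1 @[k --> \oo] --> 1 * l + 0.
    apply: cvgD; last by rewrite cvg_shiftS; exact: eta_cvg0.
    by apply: cvgM => //; exact: cvg_prod_cvg1.
  by apply: cvgB; exact: cvgM.
have h2 : N k.+1 (r k.+1) ^+ 2 @[k --> \oo] --> (0 : R).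
  apply: (squeeze_cvgr (f := fun=> 0)) h; last exact: cvg_cst.
  apply: nearW => k; rewrite sqr_ge0/= lerBrDl.
  apply: le_trans (proximal_step_le _ _ T0) _.
  rewrite ler_sqr ?nnegrE ?normG_ge0 ?proximal_err_le//.
  by rewrite (le_trans (normG_ge0 _ _) (proximal_err_le _ _)).
have := cvg_comp _ _ h2 (@sqrt_continuous R 0).
rewrite /comp sqrtr0.
by under eq_fun do rewrite /= sqrtr_sqr ger0_norm ?normG_ge0//.
Qed.

Lemma proximal_projs_step_cvg0 x0 : T x0 0 ->
  P (z k.+1) - P (z k) @[k --> \oo] --> (0 : H).
Proof.
move=> T0; have [C C0 PC] := norm_projs_unif.
have -> : (fun k => P (z k.+1) - P (z k)) = (fun k => P (e k) - P (r k)).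
  apply/funext => k; rewrite -!linearB/=; congr (P _).
  by rewrite /r opprB addrCA opprD [e k + _]addrCA subrr addr0.
rewrite -(subr0 (0 : H)); apply: cvgB.
  apply: (cvg0_norm_le _ C eta) eta_cvg0; apply: nearW => k.
  by rewrite (le_trans (PC k _))// ler_wpM2l.
apply: (cvg0_norm_le _ C) (proximal_residual_cvg0 _ T0); apply: nearW => k.
exact: PC.
Qed.

Lemma proximal_image_cvg0 x0 : T x0 0 ->
  (c k)^-1 *: B k (r k) @[k --> \oo] --> (0 : H).
Proof.
move=> T0; have [C C0 NC] := normG_unif.
apply: (cvg0_norm_le _ (c_min^-1 * C)) (proximal_residual_cvg0 _ T0).
apply: filterS c_ge => k ck; rewrite normrZ gtr0_norm ?invr_gt0// -mulrA.
apply: ler_pM => //; first by rewrite invr_ge0 ltW.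
  by rewrite lef_pV2 ?posrE.
apply: (norm_aligned_le _ _ _ (alB k)) => // u.
by rewrite (le_trans (NC k u))// ler_wpM2l// norm_projs_le.
Qed.

Lemma proximal_projs_bounded x0 : T x0 0 ->
  exists M, forall k, `|P (z k.+1)| <= M.
Proof.
move=> T0; have [C C0 PC] := norm_projs_unif.
have /cvg_seq_bounded/bounded_near_globally[M NM] := proximal_cvg_dist _ T0.
exists (C * M + `|P x0|) => k.
rewrite -lerBlDr (le_trans (lerB_dist _ _))// -linearB/= (le_trans (PC k _))//.
by rewrite ler_wpM2l// (le_trans (ler_norm _))//; exact: NM.
Qed.

(** The distances to [y] converge along the whole sequence, and the subsequence identifies their
    limit as 0. *)
Lemma proximal_cvg_of_subseq y (phi : nat -> nat) : T y 0 ->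
  (forall n, (n <= phi n)%N) ->
  P (z (phi n).+1) @[n --> \oo] --> P y -> P (z k) @[k --> \oo] --> P y.
Proof.
move=> T0 phiP zy; have /cvg_ex[l al] := proximal_cvg_dist _ T0.
have [C C0 PC] := norm_projs_unif; have [D D0 ND] := normG_unif.
have al_phi : N (phi n) (z (phi n).+1 - y) @[n --> \oo] --> l.
  exact: (cvgn_comp _ (fun k => N k (z k.+1 - y))).
have al0 : N (phi n) (z (phi n).+1 - y) @[n --> \oo] --> (0 : R).
  apply: (cvg0_norm_le _ D (fun n => `|P (z (phi n).+1) - P y|)).
    by apply: nearW => n; rewrite ger0_norm ?normG_ge0// -linearB ND.
  apply/norm_cvg0P; rewrite -(subrr (P y)).
  by apply: cvgB => //; exact: cvg_cst.
have l0 : l = 0 by exact: (cvg_unique _ al_phi al0).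
rewrite -cvg_shiftS; apply/subr_cvg0.
apply: (cvg0_norm_le _ C (fun k => N k (z k.+1 - y))); last by rewrite -l0.
by apply: nearW => k; rewrite -linearB PC.
Qed.

Lemma proximal_projs_cvg : zer T !=set0 -> implementable Hs Hss T ->
  exists2 y, T y 0 & P (z k) @[k --> \oo] --> P y.
Proof.
move=> [x0 Tx0] impl; have [M PM] := proximal_projs_bounded _ Tx0.
have [phi phiP /cvg_ex[x zx]] := bounded_cvg_subseq _ _ _ PM.
have Pc : continuous P by exact: findim_linear_continuous.
have Px : P x = x.
  have h : P (z (phi n).+1) @[n --> \oo] --> P x.
    have -> : (fun n => P (z (phi n).+1)) = (fun n => P (P (z (phi n).+1))).
      by apply/funext => n; rewrite [RHS](projs_id _ _ od) ?memv_pi.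
    exact: (continuous_cvg _ (Pc x)) zx.
  exact: (cvg_unique _ h zx).
(* One exact step from the cluster point [x] gives [w = x - P y] in [T y]; the aim is [w = 0]. *)
have [y [w [Ty]]] := impl 1 P x ltr01 (aligned_projs _ _ od).
rewrite invr1 scale1r => /esym/eqP; rewrite addr_eq0 => /eqP wE.
have h : dot (P (z (phi n).+1) - P y)
      ((c (phi n))^-1 *: B (phi n) (r (phi n)) - w)
    @[n --> \oo] --> dot (x - P y) (0 - w).
  apply: cvg_dot; apply: cvgB => //; try exact: cvg_cst.
  exact: (cvgn_comp _ (fun k => _)) (proximal_image_cvg0 _ Tx0).
have : 0 <= dot (x - P y) (0 - w).
  rewrite -(cvg_lim _ h)//; apply: limr_ge.
    by apply/cvg_ex; eexists; exact: h.
  (* Both images lie in [Hs], so only the [Hs] components of the points enter; the other components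
     need not converge. *)
  apply: nearW => n; rewrite -linearB/= dot_mem_Hs//.
    exact: (mmT.1 _ _ _ _ (zT _) Ty).
  by rewrite rpredB ?rpredZ ?(aligned_mem Hs Hss)// wE rpredN memv_pi.
(* The limit inequality now reads [- |x - P y|^2 >= 0]. *)
have -> : 0 - w = - (x - P y) by rewrite sub0r wE opprK linearB/= Px opprB.
rewrite dotNr oppr_ge0 -dot_normE => xy0.
have /eqP : `|x - P y| ^+ 2 = 0 by apply/eqP; rewrite eq_le xy0 sqr_ge0.
rewrite sqrf_eq0 normr_eq0 subr_eq0 => /eqP xPy.
have w0 : w = 0 by rewrite wE linearB/= Px xPy subrr oppr0.
rewrite w0 in Ty; exists y => //.
by apply: (proximal_cvg_of_subseq _ phi) => //; rewrite -xPy.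
Qed.

End ProximalIteration.

(** * Boundedness from a bounded completion set *)

Section Boundedness.
Context {R : realType} {H : finHilbertType R}.
Variables (Hs Hss : {vspace H}) (od : orthogonal_decomposition Hs Hss).
Variables (T : H -> set H) (mmT : maximal_monotone T).

Local Notation P := (daddv_pi Hs Hss).

(** Moving by [t d] adds [t <d, wts - v>] to each monotonicity inequality. Since [d] is orthogonal
    to [wts], this is [- t <d, v> >= 0], and maximality concludes. *)
Lemma completion_recession (d : H) (zts wts : subvs_of Hs)
    (a : subvs_of Hss) t :
  d \in Hss -> (forall y v, T y v -> dot d v <= 0) -> 0 <= t ->
  completion Hs Hss T zts wts a ->
  completion Hs Hss T zts wts (a + t *: vsproj Hss d).
Proof.
move=> dHss dT t0 Ta; apply: (maximal_monotone_mem _ mmT) => y v Tyv.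
have -> : join2 zts (a + t *: vsproj Hss d) - y = (join2 zts a - y) + t *: d.
  by rewrite /join2 linearD linearZ/= vsprojK// addrA [LHS]addrAC.
rewrite dotDl dotZl addr_ge0 ?(mmT.1 _ _ _ _ Ta Tyv)// mulr_ge0//.
rewrite /join2 linear0 addr0 dotDr (dotC d) od.2 ?subvsP// add0r dotNr oppr_ge0.
exact: dT Tyv.
Qed.

(* Otherwise a limit [d] of the normalized [x n] would be a unit recession
   direction of the anchoring completion set. *)
Lemma anchored_bounded (x s : nat -> H) (M : R) (zts wts : subvs_of Hs) :
  (forall n, T (x n) (s n)) -> s @ \oo --> (0 : H) ->
  (forall n, `|P (x n)| <= M) -> projected Hs Hss T zts wts ->
  bounded_set [set vsval v | v in completion Hs Hss T zts wts] ->
  exists K, forall n, `|x n| <= K.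
Proof.
move=> Txs s0 PM [a Ta] /bounded_near_globally[K0 K0P]; apply: contrapT => nb.
have step n : exists p, (n <= p)%N && (n.+1%:R < `|x p|).
  apply: contrapT => np; apply: nb.
  (* The sum dominates the first [n] norms, so exceeding this bound forces an index of at least
     [n]. *)
  exists (n.+1%:R + \sum_(i < n) `|x i|) => p; rewrite leNgt; apply/negP => xp.
  apply: np; exists p; have [np|pn] := leqP n p; rewrite /=.
    by rewrite (le_lt_trans _ xp)// lerDl sumr_ge0.
  move: xp; rewrite ltNge => /negP; case.
  by rewrite (bigD1 (Ordinal pn))//= addrCA lerDl addr_ge0// sumr_ge0.
pose phi n := xchoose (step n).
have phiP n : (n <= phi n)%N && (n.+1%:R < `|x (phi n)|) := xchooseP (step n).
pose d n := `|x (phi n)|^-1 *: x (phi n).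
have xphi0 n : 0 < `|x (phi n)|.
  by case/andP: (phiP n) => _; apply: lt_trans.
have d1 n : `|d n| = 1.
  by rewrite /d normrZ normfV normr_id mulVf// gt_eqF.
have d_le1 n : `|d n| <= 1 by rewrite d1.
have [psi psiP /cvg_ex[dd ddP]] := bounded_cvg_subseq _ d 1 d_le1.
pose q n := phi (psi n).
have qP n : (n <= q n)%N.
  by case/andP: (phiP (psi n)) => /(leq_trans (psiP n)).
pose t n := `|x (q n)|^-1.
have t0 : t @ \oo --> (0 : R).
  apply: (cvg0_norm_le t 1 (@harmonic R)); last exact: cvg_harmonic.
  apply: nearW => n; rewrite mul1r /t normfV normr_id /harmonic/=.
  rewrite lef_pV2 ?posrE ?xphi0//.
  case/andP: (phiP (psi n)) => _ /ltW; apply: le_trans.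
  by rewrite ler_nat ltnS.
have ddn1 : `|dd| = 1.
  have h : `|d (psi n)| @[n --> \oo] --> `|dd| by apply: cvg_norm; exact: ddP.
  have h1 : `|d (psi n)| @[n --> \oo] --> (1 : R).
    by under eq_fun do rewrite d1; exact: cvg_cst.
  exact: (cvg_unique _ h h1).
(* The [Hs] components stay bounded by [M] while being divided by norms that tend to infinity. *)
have ddHss : dd \in Hss.
  have Pc : continuous P by exact: findim_linear_continuous.
  have h : P (d (psi n)) @[n --> \oo] --> P dd.
    exact: (continuous_cvg _ (Pc dd)) ddP.
  have h0 : P (d (psi n)) @[n --> \oo] --> (0 : H).
    apply: (cvg0_norm_le _ M t) t0; apply: nearW => n.
    rewrite /d linearZ/= normrZ normfV normr_id mulrC.
    by rewrite ler_wpM2r// invr_ge0.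
  have Pdd : P dd = 0 by exact: (cvg_unique _ h h0).
  by rewrite -(add_proj _ _ od dd) Pdd add0r memv_pi.
(* Divide the monotonicity inequality between [x (q n)] and [y] by [|x (q n)|] and let [n] tend to
   infinity. *)
have ddT y v : T y v -> dot dd v <= 0.
  move=> Tyv.
  have h : dot (d (psi n) - t n *: y) (s (q n) - v) @[n --> \oo]
      --> dot (dd - 0 *: y) (0 - v).
    apply: cvg_dot; apply: cvgB => //; try exact: cvg_cst.
      by apply: cvgZl.
    exact: cvgn_comp.
  have : 0 <= dot (dd - 0 *: y) (0 - v).
    rewrite -(cvg_lim _ h)//; apply: limr_ge.
      by apply/cvg_ex; eexists; exact: h.
    apply: nearW => n; rewrite /d -scalerBr dotZl mulr_ge0 ?invr_ge0//.
    exact: mmT.1.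
  by rewrite scale0r subr0 sub0r dotNr oppr_ge0.
have K1 t' : 0 <= t' -> `|vsval a + t' *: dd| <= K0.
  move=> t'0; apply: K0P; exists (a + t' *: vsproj Hss dd).
    exact: completion_recession.
  by rewrite linearD linearZ/= vsprojK.
have K00 : 0 <= K0 by rewrite (le_trans _ (K1 0 _)).
(* For this [t] the norm of [a + t dd] is at least [t - |a| = K0 + 1]. *)
have := K1 (K0 + `|vsval a| + 1).
rewrite addr_ge0// ?addr_ge0// => /(_ isT).
rewrite addrC leNgt => /negP; apply.
rewrite (lt_le_trans _ (lerB_normD _ _))// normrZ ddn1 mulr1.
by rewrite ger0_norm ?addr_ge0//; lra.
Qed.

End Boundedness.

(** * Reduction of the theorem to the perturbed iteration *)

Lemma ereal_cvg_lower_bound {R : realType} (c : nat -> R) (cinf : \bar R) :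
  (0 < cinf)%E -> (c k)%:E @[k --> \oo] --> cinf ->
  exists2 m : R, 0 < m & \forall k \near \oo, m <= c k.
Proof.
move=> c0 cc; have [m m0 mc] : exists2 m : R, 0 < m & (m%:E < cinf)%E.
  case: cinf c0 {cc} => [r|_|//]; last by exists 1; rewrite ?ltry.
  by rewrite lte_fin => r0; exists (r / 2); rewrite ?lte_fin; lra.
exists m => //.
have := cc _ (open_nbhs_nbhs (conj (@open_ereal_gt_ereal R m%:E) mc)).
by case=> N _ Nc; exists N => // k /Nc /=; rewrite lte_fin => /ltW.
Qed.

Theorem theorem4p3 (R : realType) (H : finHilbertType R)
    (Hs Hss : {vspace H}) (T : H -> set H)
    (c alpha eps : nat -> R) (cinf : \bar R)
    (B : nat -> 'End(H)) (z : nat -> H) :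
  orthogonal_decomposition Hs Hss ->
  maximal_monotone T ->
  zer T !=set0 ->
  implementable Hs Hss T ->
  (forall k, 0 < c k) ->
  (forall k, aligned Hs Hss (B k)) ->
  (forall k, (1 <= k)%N -> 1 <= alpha k) ->
  (forall k, (1 <= k)%N -> forall u : subvs_of Hs,
    (alpha k)^-1 * normG (dot_star Hs) (restrict_star Hs (B k.-1)) u
      <= normG (dot_star Hs) (restrict_star Hs (B k)) u
      <= alpha k * normG (dot_star Hs) (restrict_star Hs (B k.-1)) u) ->
  cvgn (fun n => \prod_(1 <= k < n.+1) alpha k) ->
  (0 < cinf)%E ->
  (c k)%:E @[k --> \oo] --> cinf ->
  (forall k, 0 <= eps k < 1) ->
  (\sum_(0 <= k <oo) (eps k)%:E < +oo)%E ->
  (forall k,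
    ((c k)%:E * distG (dot_star Hs) (restrict_star Hs (B k))^-1%VF 0
       (residual_star Hs Hss T (c k) (B k) (z k) (z k.+1)) <= (eps k)%:E)%E) ->
  exists zbars : subvs_of Hs,
    [/\ vsval (star Hs Hss (z k)) @[k --> \oo] --> vsval zbars,
        zer (projected Hs Hss T) zbars,
        vsval (star Hs Hss (z k.+1)) - vsval (star Hs Hss (z k))
          @[k --> \oo] --> (0 : H) &
        (exists zts wts : subvs_of Hs, projected Hs Hss T zts wts /\
          bounded_set [set vsval v | v in completion Hs Hss T zts wts]) ->
        [/\ bounded_set (range z),
            cluster (z k @[k --> \oo]) `<=` zer T &
            forall zbarss : subvs_of Hss,
              completion Hs Hss T zbars 0 = [set zbarss] ->
              [/\ vsval (dstar Hs Hss (z k)) @[k --> \oo] --> vsval zbarss,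
                  z k @[k --> \oo] --> join2 zbars zbarss &
                  T (join2 zbars zbarss) 0]]].
Proof.
move=> od mmT zerT impl c0 alB alpha1 ratio calpha cinf0 ccinf eps01 epsS dist.
pose beta k := alpha k.+1.
(* The geometric slack is needed because the infimum defining [distG] is not
   known to be attained. *)
pose eta k := eps k + geometric 1 2^-1 k.
have geo0 k : 0 < geometric (1 : R) 2^-1 k.
  by rewrite /geometric/= mul1r exprn_gt0.
have /choice[e eP] k : exists e, normG dot (B k) e <= eta k /\
    T (z k.+1) ((c k)^-1 *: B k (z k + e - z k.+1)).
  exact: (residual_perturbation _ _ od _ (alB k)).
have beta1 k : 1 <= beta k by exact: alpha1.
(* The comparison assumed on [Hs] extends to all of [H], since the seminorms see only the [Hs]
   component. *)
have ratioH k u :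
    (beta k)^-1 * normG dot (B k) u <= normG dot (B k.+1) u
      <= beta k * normG dot (B k) u.
  have := ratio k.+1 isT (star Hs Hss u).
  rewrite !(normG_restrict_star _ _ _ (alB _)) vsval_star//.
  by rewrite !(normG_projs _ _ od _ (alB _)).
have Bsucc k u : normG dot (B k.+1) u <= beta k * normG dot (B k) u.
  by case/andP: (ratioH k u).
have Bpred k u : normG dot (B k) u <= beta k * normG dot (B k.+1) u.
  by case/andP: (ratioH k u); rewrite ler_pdivrMl// (lt_le_trans ltr01).
have cbeta : cvgn (fun n => \prod_(0 <= k < n) beta k).
  suff -> : (fun n => \prod_(0 <= k < n) beta k)
    = (fun n => \prod_(1 <= k < n.+1) alpha k) by [].
  by apply/funext => n; rewrite big_add1.
have eta0 k : 0 <= eta k.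
  by rewrite addr_ge0 ?(ltW (geo0 k))//; case/andP: (eps01 k).
have ceta : cvgn (series eta).
  apply: is_cvg_seriesD.
    by apply: nneseries_lty_cvg => // k; case/andP: (eps01 k).
  by apply: is_cvg_geometric_series; rewrite gtr0_norm ?invr_gt0//; lra.
have [m m0 mc] := ereal_cvg_lower_bound _ _ cinf0 ccinf.
have e_le k : normG dot (B k) (e k) <= eta k by case: (eP k).
have zT k : T (z k.+1) ((c k)^-1 *: B k (z k + e k - z k.+1)) by case: (eP k).
have [y Ty zy] := proximal_projs_cvg _ _ od _ mmT _ _ _ _ _ _ c0 alB beta1 Bsucc
  Bpred cbeta eta0 ceta e_le zT _ m0 mc zerT impl.
have dz := proximal_projs_step_cvg0 _ _ od _ mmT _ _ _ _ _ _ c0 alB beta1 Bsucc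
  Bpred cbeta eta0 ceta e_le zT _ Ty.
have s0 := proximal_image_cvg0 _ _ od _ mmT _ _ _ _ _ _ c0 alB beta1 Bsucc
  cbeta eta0 ceta e_le zT _ m0 mc _ Ty.
have zerT_of_subseq (phi : nat -> nat) p : (forall n, (n <= phi n)%N) ->
    z (phi n) @[n --> \oo] --> p -> T p 0.
  (* The inclusions concern [z k.+1] only; [phi n.+1] is positive, hence a successor. *)
  move=> phiP zp; pose psi n := (phi n.+1).-1.
  have psiS n : (psi n).+1 = phi n.+1.
    by rewrite /psi prednK// (leq_trans _ (phiP n.+1)).
  apply: (maximal_monotone_closed _ mmT _ _ _ _ (fun n => zT (psi n))).
    have zS : z (phi n.+1) @[n --> \oo] --> p.
      by rewrite (cvg_shiftS (z \o phi)).
    by under eq_fun do rewrite psiS.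
  apply: (cvgn_comp _ _ _ _ _ s0) => n.
  by rewrite -ltnS psiS.
exists (star Hs Hss y); split.
- by under eq_fun do rewrite vsval_star//; rewrite vsval_star.
- exists (dstar Hs Hss y); rewrite join2_star//.
  by rewrite /join2 !linear0 addr0.
- by under eq_fun do rewrite !vsval_star//.
move=> [zts [wts [anchor bnd]]].
have [K zK] : exists K, forall n, `|z n| <= K.
  have /cvg_seq_bounded/bounded_near_globally[M PM] :
    cvgn (fun k => daddv_pi Hs Hss (z k)) by apply/cvg_ex; eexists; exact: zy.
  have [K zK] := anchored_bounded _ _ od _ mmT _ _ M _ _ zT s0
    (fun n => PM n.+1 I) anchor bnd.
  (* The bound [K] covers the iterates from index 1 on; [z 0] is added by hand. *)
  exists (`|z 0%N| + `|K|) => -[|n]; first by rewrite lerDl.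
  by rewrite (le_trans (zK n))// (le_trans (ler_norm K))// lerDr.
split.
- exists K; split => [|M KM _ [n _ <-]]; first by rewrite num_real.
  by rewrite /= (le_trans (zK n))// ltW.
- by move=> p /cluster_cvg_subseq[phi phiP zp]; exact: zerT_of_subseq zp.
move=> zbarss compl.
have zl : z k @[k --> \oo] --> join2 (star Hs Hss y) zbarss.
  (* A subsequential limit [p] is a zero of [T] with [P p = P y], so its [Hss] component lies in the
     singleton completion set. *)
  apply: (cvg_of_subseq_limits _ _ K) => // phi p phiP zp.
  have Tp := zerT_of_subseq _ _ phiP zp.
  have Pp : daddv_pi Hs Hss p = daddv_pi Hs Hss y.
    have h : daddv_pi Hs Hss (z (phi n)) @[n --> \oo] --> daddv_pi Hs Hss p.
      by apply: (continuous_cvg _ (findim_linear_continuous _ _ _ p)).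
    have h' := cvgn_comp _ _ _ _ phiP zy.
    exact: (cvg_unique _ h h').
  have sp : star Hs Hss p = star Hs Hss y.
    by apply: val_inj; rewrite /= !vsval_star.
  have : completion Hs Hss T (star Hs Hss y) 0 (dstar Hs Hss p).
    rewrite /completion/= -sp join2_star//.
    by rewrite /join2 !linear0 addr0.
  by rewrite compl => /= <-; rewrite -sp join2_star.
have Tl : T (join2 (star Hs Hss y) zbarss) 0 by exact: (zerT_of_subseq id).
split => //.
have -> : vsval zbarss = daddv_pi Hss Hs (join2 (star Hs Hss y) zbarss).
  rewrite /join2 linearD/= (projss_id _ _ od (vsval zbarss)) ?subvsP//.
  rewrite (projs_ss Hss Hs) ?subvsP ?add0r//.
  case: od => odD od0; split; first by rewrite addvC.
  by move=> u v uH vH; rewrite dotC od0.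
under eq_fun do rewrite vsval_dstar//.
exact: (continuous_cvg _ (findim_linear_continuous _ _ _ _)).
Qed.
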